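(* There exists a universal constant $C$ such that, for every graph-hypergraph pair $(G,\mathcal{H})$, if $\epsilon(\mathcal{H})\ge C\log\Delta(\mathcal{H})$, then there is an odd $k$-colouring of $(G,\mathcal{H})$, where $$k\le \Delta(G)+C\log\Delta(\mathcal{H}).$$
   Context: All graphs are finite, undirected and simple. A hypergraph $\mathcal{H}=(V(\mathcal{H}),E(\mathcal{H}))$ is a generalisation of a graph whose edges are subsets of $V(\mathcal{H})$ of arbitrary positive size. A graph-hypergraph pair $(G,\mathcal{H})$ consists of a graph $G$ and a hypergraph $\mathcal{H}$ on the same vertex set $V$. $\Delta(G)$ and $\Delta(\mathcal{H})$ denote maximum degrees, where the degree of a vertex in a graph or hypergraph is the number of its edges containing that vertex; $\epsilon(\mathcal{H})$ is the minimum size of an edge of $\mathcal{H}$. An odd $k$-colouring of $(G,\mathcal{H})$ is a map $\sigma\colon V\to\{1,\dots,k\}$ that is a proper colouring of $G$ (adjacent vertices receive different colours) and such that for every $e\in E(\mathcal{H})$ some colour appears an odd number of times on $e$.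
   Formalization: Proved under the added assumption Δ(H) ≥ 2: for Δ(H) = 1 the logarithm is 0 and the claim fails for G = K_n with H = {V}, and for Δ(H) = 0 both log Δ(H) and ε(H) are undefined. *)

(* Defs.v *)
From HB Require Import structures.
From mathcomp Require Import all_boot all_order all_algebra.
From mathcomp Require Import reals exp.

Set Implicit Arguments.
Unset Strict Implicit.
Unset Printing Implicit Defensive.

Record sgraph (V : finType) := SGraph {
  adj : rel V;
  adj_sym : symmetric adj;
  adj_irrefl : irreflexive adj }.

Record hypergraph (V : finType) := Hypergraph {
  hedges : {set {set V}};
  hedges_neq0 : set0 \notin hedges }.

Definition gdeg (V : finType) (G : sgraph V) (v : V) : nat :=
  #|[set u | adj G v u]|.

Definition gmaxdeg (V : finType) (G : sgraph V) : nat :=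
  \max_(v : V) gdeg G v.

Definition hdeg (V : finType) (H : hypergraph V) (v : V) : nat :=
  #|[set e in hedges H | v \in e]|.

Definition hmaxdeg (V : finType) (H : hypergraph V) : nat :=
  \max_(v : V) hdeg H v.

(* Since #|e| <= #|V| for every edge e, the default value #|V| does not
   affect the minimum as soon as H has an edge. *)
Definition hminsize (V : finType) (H : hypergraph V) : nat :=
  \big[minn/#|V|]_(e in hedges H) #|e|.

Definition proper_colouring (V : finType) (G : sgraph V) (k : nat)
    (sigma : V -> 'I_k) : Prop :=
  forall u v : V, adj G u v -> sigma u != sigma v.

Definition odd_on_edges (V : finType) (H : hypergraph V) (k : nat)
    (sigma : V -> 'I_k) : Prop :=
  forall e : {set V}, e \in hedges H ->
    exists c : 'I_k, odd #|[set v in e | sigma v == c]|.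

Definition odd_colouring (V : finType) (G : sgraph V) (H : hypergraph V)
    (k : nat) (sigma : V -> 'I_k) : Prop :=
  proper_colouring G sigma /\ odd_on_edges H sigma.

(* Main.v *)
Require Import Defs.
From HB Require Import structures.
From mathcomp Require Import all_boot all_order all_algebra.
From mathcomp Require Import reals exp.
From mathcomp Require Import zify.
Import Order.TTheory GRing.Theory Num.Theory.

(** Put [s] of order [log2] of the maximum degree of [H], give [G] a uniformly
random proper colouring with [gmaxdeg G + 64 * s] colours, and call an edge
[e] bad when every colour occurs on it an even number of times.  A lopsided
form of the local lemma shows that with positive probability no edge is bad.

Edges may be arbitrarily large, so an edge can meet far too many others for
the usual dependency graph.  Instead a set [S e] of exactly [s] vertices is
fixed inside each edge [e], and the colouring is exposed outside [S e].  This
decides whether [f] is bad for every edge [f] disjoint from [S e], and at most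
[s * hmaxdeg H] edges are not disjoint from it.  It therefore suffices that,
whatever is exposed outside [S e], a fraction at most [2 ^- s] of the proper
extensions to [S e] makes [e] bad ([card_even_avoiding]); then
[lopsided_local_lemma] applies as soon as [4 * (s * hmaxdeg H) <= 2 ^ s].

Once the outside is exposed, [e] is bad only if the set of colours occurring
an odd number of times on [S e] is one prescribed set [P].  Colour the
vertices of [S e] one at a time: each has at least [64 * s] colours allowed by
the outside, of which fewer than [s] are blocked by earlier choices, and each
choice flips the membership of one colour in the difference between [P] and
the current odd set.  For this difference to end up empty it must never exceed
the number of choices left, which is at most [s], and at least half of the
choices must shrink it; each of those had probability at most about [1 / 64].
The induction in [card_odd_colours_pattern] makes this
precise, choosing backwards and weighting a target [P] with [8 ^ #|P|]. *)

Set Implicit Arguments.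
Unset Strict Implicit.
Unset Printing Implicit Defensive.

Lemma exists_subset_card (T : finType) (A : {set T}) (s : nat) :
  s <= #|A| -> exists2 S : {set T}, S \subset A & #|S| = s.
Proof.
move=> sA; exists [set x in take s (enum A)].
  by apply/subsetP => x; rewrite inE => /mem_take; rewrite mem_enum.
rewrite cardsE (card_uniqP _) ?take_uniq ?enum_uniq //.
by rewrite size_takel // -cardE.
Qed.

(** * A lopsided local lemma, by counting *)

Section LocalLemma.
Variables (T E : finType) (Omega : {set T}) (bad : E -> pred T).

Definition avoiding (F : {set E}) : {set T} :=
  [set x in Omega | [forall f in F, ~~ bad f x]].

(** Only a one-sided dependency [nb] is required: the bound on [bad e] has to
survive conditioning on avoiding any events outside [nb e].  Working with the
uniform measure on [Omega] turns conditional probabilities into cardinals.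
The inductive claim is that the conditional probability of [bad e] given that
[F] is avoided is at most [2 / q]: dropping [F :&: nb e] from the condition
costs a factor at most [2], since by induction the dropped events have total
probability at most [d * (2 / q) <= 1 / 2]. *)
Lemma lopsided_local_lemma (A : {set E}) (nb : E -> {set E}) (d q : nat) :
  (forall e (F : {set E}), e \in A -> F \subset A -> [disjoint F & nb e] ->
     q * #|[set x in avoiding F | bad e x]| <= #|avoiding F|) ->
  (forall e, e \in A -> #|nb e| <= d) ->
  4 * d <= q -> 2 < q -> 0 < #|Omega| -> 0 < #|avoiding A|.
Proof.
move=> indep nbd dq q2 Omega0.
have key (F : {set E}) e : e \in A -> F \subset A ->
    q * #|[set x in avoiding F | bad e x]| <= 2 * #|avoiding F|.
  have [n] := ubnP #|F|; elim: n F e => // n IHn F e Fn eA FA.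
  pose F2 := F :\: nb e.
  have F2F : F2 \subset F by apply: subsetDl.
  have F2A : F2 \subset A := subset_trans F2F FA.
  have disj : [disjoint F2 & nb e].
    by rewrite -setI_eq0; apply/eqP/setP => f; rewrite !inE; case: (f \in nb e); rewrite ?andbF.
  have badF : #|[set x in avoiding F | bad e x]|
              <= #|[set x in avoiding F2 | bad e x]|.
    apply/subset_leq_card/subsetP => x; rewrite !inE.
    move=> /andP[/andP[-> /forall_inP h] ->]; rewrite andbT /=.
    by apply/forall_inP => f fF2; apply: h; apply: (subsetP F2F).
  have [FE|F2n] := eqVneq F2 F.
    apply: leq_trans (leq_mul (leqnn q) badF) _.
    by apply: leq_trans (indep e F2 eA F2A disj) _; rewrite FE leq_pmull.
  have F2ltn : #|F2| < n.
    have : F2 \proper F by rewrite properEneq F2n.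
    by move=> /proper_card; lia.
  have lossF : #|avoiding F2| <=
      #|avoiding F| + \sum_(f in nb e :&: F) #|[set x in avoiding F2 | bad f x]|.
    have sub : avoiding F2 \subset avoiding F :|:
        \bigcup_(f in nb e :&: F) [set x in avoiding F2 | bad f x].
      apply/subsetP => x xF2; rewrite in_setU.
      have [//|/= xF] := boolP (x \in avoiding F).
      move: (xF2) xF; rewrite !inE => /andP[-> /forall_inP h2] /=.
      rewrite negb_forall_in => /exists_inP[f fF]; rewrite negbK => fx.
      apply/bigcupP; exists f; last by rewrite inE xF2.
      rewrite inE fF andbT; apply: contraLR fx => fnb.
      by apply: h2; rewrite inE fnb.
    apply: leq_trans (subset_leq_card sub) _.
    apply: leq_trans (leq_card_setU _ _) _; rewrite leq_add2l.
    elim/big_rec2: _ => [|f m B _ Bm]; first by rewrite cards0.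
    by apply: leq_trans (leq_card_setU _ _) _; rewrite leq_add2l.
  have lossq : q * \sum_(f in nb e :&: F) #|[set x in avoiding F2 | bad f x]|
               <= d * (2 * #|avoiding F2|).
    rewrite big_distrr /=.
    apply: (@leq_trans (\sum_(f in nb e :&: F) 2 * #|avoiding F2|)).
      apply: leq_sum => f /setIP[_ fF].
      by apply: IHn => //; apply: (subsetP FA).
    rewrite sum_nat_const leq_mul2r; apply/orP; right.
    by apply: leq_trans (nbd e eA); apply/subset_leq_card/subsetIl.
  have := indep e F2 eA F2A disj.
  nia.
(* Adding the events one by one keeps a fraction 1 - 2 / q > 0 each time. *)
suff posF (F : {set E}) : F \subset A -> 0 < #|avoiding F| by apply: posF.
have [n] := ubnP #|F|; elim: n F => // n IHn F Fn FA.
have [->|[e eF]] := set_0Vmem F.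
  rewrite (_ : avoiding set0 = Omega) //; apply/setP => x; rewrite inE.
  by rewrite (_ : [forall _ in _, _]) ?andbT //; apply/forall_inP => f; rewrite inE.
have FeA : F :\ e \subset A by apply: subset_trans FA; apply: subsetDl.
have := IHn (F :\ e) _ FeA; have := cardsD1 e F; rewrite eF => cF.
have /[swap]/[apply] : #|F :\ e| < n by lia.
have := key (F :\ e) e (subsetP FA _ eF) FeA.
have := cardsID [set x | bad e x] (avoiding (F :\ e)).
have -> : avoiding (F :\ e) :&: [set x | bad e x] =
          [set x in avoiding (F :\ e) | bad e x].
  by apply/setP => x; rewrite !inE.
have -> : avoiding (F :\ e) :\: [set x | bad e x] = avoiding F.
  apply/setP => x; rewrite !inE andbCA; congr andb.
  apply/andP/forall_inP => [[ex /forall_inP h] f fF|h].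
    by have [->//|fe] := eqVneq f e; apply: h; rewrite !inE fe.
  split; first exact: h.
  by apply/forall_inP => f /setD1P[_]; apply: h.
nia.
Qed.

End LocalLemma.

(** * Proper colourings modified on a small set *)

Section Colourings.
Variables (V : finType) (G : sgraph V) (k : nat).
Implicit Types (sigma tau : {ffun V -> 'I_k}) (D S U W : {set V}).

Definition proper_on U sigma :=
  [forall u in U, forall v in U, adj G u v ==> (sigma u != sigma v)].

Definition recolour sigma v c : {ffun V -> 'I_k} :=
  [ffun u => if u == v then c else sigma u].

Definition free_colours v U sigma : {set 'I_k} :=
  [set c | [forall u in U, adj G v u ==> (sigma u != c)]].

(** The vertices outside [W :|: D] keep their colour from [sigma0] without
having to be coloured properly, so that the vertices of a set can be moved into
[D] one at a time. *)
Definition recolourings sigma0 W D : {set {ffun V -> 'I_k}} :=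
  [set sigma : {ffun V -> 'I_k} | [forall v in ~: D, sigma v == sigma0 v]
             & proper_on (W :|: D) sigma].

Definition odd_colours D sigma : {set 'I_k} :=
  [set c | odd #|[set v in D | sigma v == c]|].

Definition even_on (e : {set V}) : pred {ffun V -> 'I_k} :=
  [pred sigma | odd_colours e sigma == set0].

Definition proper_colourings : {set {ffun V -> 'I_k}} :=
  [set sigma | proper_on setT sigma].

Lemma proper_onP U sigma :
  reflect {in U &, forall u v, adj G u v -> sigma u != sigma v}
          (proper_on U sigma).
Proof.
apply: (iffP forall_inP) => [h u v uU vU|h u uU].
  by move/forall_inP: (h u uU) => /(_ v vU)/implyP.
by apply/forall_inP => v vU; apply/implyP; apply: h.
Qed.

Lemma recolouringsP sigma0 W D sigma :
  reflect ((forall v, v \notin D -> sigma v = sigma0 v)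
           /\ proper_on (W :|: D) sigma)
          (sigma \in recolourings sigma0 W D).
Proof.
rewrite inE; apply: (iffP andP) => -[h ->]; split=> //.
  by move=> v vD; apply/eqP; move/forall_inP: h; apply; rewrite inE.
by apply/forall_inP => v; rewrite inE => /h ->.
Qed.

Lemma free_coloursP v U sigma c :
  reflect {in U, forall u, adj G v u -> sigma u != c}
          (c \in free_colours v U sigma).
Proof.
rewrite inE; apply: (iffP forall_inP) => h u uU.
  by apply/implyP; apply: h.
by apply/implyP; apply: h.
Qed.

Lemma card_free_colours_ge v U sigma :
  k <= #|free_colours v U sigma| + gdeg G v.
Proof.
have := cardsC (free_colours v U sigma); rewrite card_ord => {1}<-.
rewrite leq_add2l; apply: leq_trans (leq_imset_card sigma _).
apply/subset_leq_card/subsetP => c; rewrite !inE negb_forall_in.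
move=> /exists_inP[u uU]; rewrite negb_imply negbK => /andP[uv /eqP <-].
by apply: imset_f; rewrite inE.
Qed.

(** A vertex of [D] blocks at most one colour. *)
Lemma card_free_coloursU v W D sigma :
  #|free_colours v W sigma| <= #|free_colours v (W :|: D) sigma| + #|D|.
Proof.
have sub : free_colours v W sigma \subset
    free_colours v (W :|: D) sigma :|: sigma @: D.
  apply/subsetP => c /free_coloursP cW; rewrite in_setU.
  have [|cD] := boolP (c \in sigma @: D); first by rewrite orbT.
  rewrite orbF.
  apply/free_coloursP => u /setUP[/cW//|uD] _.
  by apply: contraNneq cD => <-; apply: imset_f.
apply: leq_trans (subset_leq_card sub) _.
apply: leq_trans (leq_card_setU _ _) _.
by rewrite leq_add2l leq_imset_card.
Qed.

Lemma free_colours_sub sigma0 v W D sigma :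
  [disjoint W & D] -> sigma \in recolourings sigma0 W D ->
  free_colours v (W :|: D) sigma \subset free_colours v W sigma0.
Proof.
move=> WD /recolouringsP[eq0 _]; apply/subsetP => c /free_coloursP h.
apply/free_coloursP => u uW vu; rewrite -eq0 ?(disjointFr WD) //.
by apply: h => //; rewrite inE uW.
Qed.

Lemma recolour_in sigma0 W D v sigma c :
  v \notin W :|: D -> sigma \in recolourings sigma0 W D ->
  (recolour sigma v c \in recolourings sigma0 W (v |: D))
    = (c \in free_colours v (W :|: D) sigma).
Proof.
move=> vWD /recolouringsP[eq0 /proper_onP prop].
have nev u : u \in W :|: D -> (u == v) = false.
  by move=> uWD; apply: contraNF vWD => /eqP <-.
apply/recolouringsP/free_coloursP => [[_ /proper_onP h] u uWD vu|h].
  have := h u v; rewrite !ffunE eqxx nev //; apply.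
  - by rewrite setUCA inE uWD orbT.
  - by rewrite setUCA !inE eqxx.
  - by rewrite adj_sym.
split=> [u|].
  by rewrite !inE negb_or ffunE => /andP[/negPf -> /eq0].
apply/proper_onP => x y; rewrite setUCA !(in_setU1 _ v) !ffunE.
case: (eqVneq x v) => [->|xv] /= xU; case: (eqVneq y v) => [->|yv] //= yU.
- by rewrite adj_irrefl.
- by move=> /h; rewrite eq_sym; apply.
- by rewrite adj_sym; apply: h.
- exact: prop.
Qed.

(** Enlarging [D] by [v] amounts to choosing a recolouring of [D] and then a
colour for [v]; the first component is recovered by giving [v] its colour from
[sigma0] back. *)
Lemma card_recolourings_step sigma0 W D v (Q : pred {ffun V -> 'I_k}) :
  v \notin W :|: D ->
  #|[set tau in recolourings sigma0 W (v |: D) | Q tau]|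
  = \sum_(sigma in recolourings sigma0 W D)
      #|[set c in free_colours v (W :|: D) sigma | Q (recolour sigma v c)]|.
Proof.
move=> vWD; have vD : v \notin D by apply: contraNN vWD; rewrite inE orbC => ->.
rewrite -sum1_card.
rewrite (partition_big (fun tau => recolour tau v (sigma0 v))
           (mem (recolourings sigma0 W D))) /=; last first.
  move=> tau; rewrite inE => /andP[/recolouringsP[eq0 /proper_onP h] _].
  apply/recolouringsP; split=> [u uD|].
    rewrite ffunE; case: eqP => [->//|/eqP uv].
    by apply: eq0; rewrite !inE negb_or uv.
  have nev u : u \in W :|: D -> (u == v) = false.
    by move=> uWD; apply: contraNF vWD => /eqP <-.
  apply/proper_onP => x y xU yU; rewrite !ffunE !nev //.
  by apply: h; rewrite setUCA inE ?xU ?yU orbT.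
apply: eq_bigr => sigma sD; rewrite sum1_card.
have /recolouringsP[eq0 _] := sD.
have inj : injective (recolour sigma v).
  by move=> c c' /ffunP/(_ v); rewrite !ffunE eqxx.
rewrite -(card_imset _ inj); apply: eq_card => tau.
apply/idP/imsetP => [|[c]].
  rewrite unfold_in /= inE => /andP[/andP[tU Qt] /eqP st].
  have tE : tau = recolour sigma v (tau v).
    by apply/ffunP => u; rewrite -st !ffunE; case: eqP => [->|].
  exists (tau v) => //; rewrite inE -tE Qt andbT.
  by rewrite -(recolour_in _ vWD sD) -tE.
rewrite inE => /andP[cf Qc] ->; rewrite unfold_in /= inE Qc andbT.
rewrite (recolour_in _ vWD sD) cf /=; apply/eqP/ffunP => u; rewrite !ffunE.
by case: eqP => // ->; rewrite eq0.
Qed.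

Lemma recolourings0 sigma0 W :
  proper_on W sigma0 -> recolourings sigma0 W set0 = [set sigma0].
Proof.
move=> pW; apply/setP => sigma; rewrite in_set1.
apply/recolouringsP/eqP => [[h _]|->]; last by rewrite setU0.
by apply/ffunP => v; apply: h; rewrite inE.
Qed.

Lemma card_odd_colours D sigma : #|odd_colours D sigma| <= #|D|.
Proof.
apply: leq_trans (leq_imset_card sigma _); apply/subset_leq_card/subsetP => c.
rewrite inE => /odd_gt0/card_gt0P[v]; rewrite inE => /andP[vD /eqP <-].
exact: imset_f.
Qed.

(** Parity is additive: over a disjoint union the odd sets combine by symmetric
difference. *)
Lemma odd_coloursU D D' sigma c : [disjoint D & D'] ->
  (c \in odd_colours (D :|: D') sigma)
  = (c \in odd_colours D sigma) (+) (c \in odd_colours D' sigma).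
Proof.
move=> DD'; rewrite !inE -oddD -cardsUI.
rewrite (_ : _ :&: _ = set0) ?cards0 ?addn0; last first.
  apply/setP => v; rewrite !inE; case: (boolP (v \in D)) => //= vD.
  by rewrite (disjointFr DD' vD) andbF.
by congr (odd #|pred_of_set _|); apply/setP => v; rewrite !inE andb_orl.
Qed.

Lemma eq_odd_colours D sigma tau :
  {in D, sigma =1 tau} -> odd_colours D sigma = odd_colours D tau.
Proof.
move=> eqD; apply/setP => c; rewrite !inE; congr (odd #|pred_of_set _|).
by apply/setP => v; rewrite !inE; case: (boolP (v \in D)) => //= /eqD ->.
Qed.

Lemma odd_colours_recolour D v sigma c c' : v \notin D ->
  (c' \in odd_colours (v |: D) (recolour sigma v c))
  = (c' == c) (+) (c' \in odd_colours D sigma).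
Proof.
move=> vD; rewrite odd_coloursU; last by rewrite disjoints1.
rewrite (@eq_odd_colours D _ sigma); last first.
  by move=> u uD; rewrite ffunE; case: eqP uD vD => // -> ->.
congr addb; rewrite inE.
have -> : [set u in [set v] | recolour sigma v c u == c']
          = if c' == c then [set v] else set0.
  apply/setP => u; rewrite !inE ffunE.
  by case: (eqVneq c' c) => [->|cc]; rewrite !inE; case: eqP => //=;
    rewrite ?eqxx // eq_sym (negPf cc).
by case: eqP; rewrite ?cards1 ?cards0.
Qed.

(** The number of extensions with odd set [P] is compared with the number of all
extensions, by induction on [D].  Let [T] be the number of extensions to
[D :\ v] and [L] the list of colours allowed at [v] by [W].  If [v] receives
[c], the odd set before was [P] with [c] flipped.  For the at most [#|P| <= s]
colours [c] in [P] the earlier target is smaller, and the weight of the bound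
worsens by a factor [8]; for the at most [#|L|] other colours it improves by a
factor [8].  The pattern thus has weighted count at most
[2 * (8 * s + #|L| / 8) * T <= #|L| / 2 * T], while at least
[(#|L| - s) * T >= #|L| / 2 * T] extensions exist. *)
Lemma card_odd_colours_pattern sigma0 W D s (P : {set 'I_k}) :
  [disjoint W & D] -> #|D| <= s -> proper_on W sigma0 ->
  {in D, forall v, 64 * s <= #|free_colours v W sigma0|} ->
  #|[set sigma in recolourings sigma0 W D | odd_colours D sigma == P]|
    * (2 ^ #|D| * 8 ^ #|P|) <= #|recolourings sigma0 W D|.
Proof.
move=> + + pW; have [n] := ubnP #|D|; elim: n D P => // n IHn D P Dn WD Ds large.
(* |D| choices flip at most |D| colours, so a larger P is never reached. *)
have [|PD] := ltnP #|D| #|P|.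
  move=> DP; rewrite (_ : [set _ in _ | _] = set0) ?cards0 //.
  apply/setP => sigma; rewrite !inE; apply/negP => /andP[_ /eqP PE].
  by have := card_odd_colours D sigma; rewrite PE leqNgt DP.
have [D0|[v vD]] := set_0Vmem D.
  have P0 : #|P| = 0 by apply/eqP; rewrite -leqn0 (leq_trans PD) // D0 cards0.
  rewrite P0 D0 cards0 muln1; apply/subset_leq_card/subsetP => sigma.
  by rewrite inE => /andP[].
pose D' := D :\ v; set T := #|recolourings sigma0 W D'|.
have DE : D = v |: D' by rewrite setD1K.
have vD' : v \notin D' by rewrite !inE eqxx.
have cD : #|D| = #|D'|.+1 by rewrite (cardsD1 v) vD.
have D'D : D' \subset D by apply: subsetDl.
have WD' : [disjoint W & D'] by apply: disjointWr WD.
have vWD' : v \notin W :|: D' by rewrite inE negb_or vD' (disjointFl WD vD).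
have IH P' : #|[set sigma in recolourings sigma0 W D' | odd_colours D' sigma == P']|
    * (2 ^ #|D'| * 8 ^ #|P'|) <= T.
  apply: IHn => //; [lia | lia | by move=> u /(subsetP D'D)/large].
set L := free_colours v W sigma0.
pose flip c : {set 'I_k} := [set c' | (c' == c) (+) (c' \in P)].
pose N c :=
  #|[set sigma in recolourings sigma0 W D' | odd_colours D' sigma == flip c]|.
have total : T * (#|L| - #|D'|) <= #|recolourings sigma0 W D|.
  have -> : recolourings sigma0 W D =
      [set tau in recolourings sigma0 W (v |: D') | xpredT tau].
    by rewrite -DE; apply/setP => tau; rewrite [RHS]inE andbT.
  rewrite card_recolourings_step //.
  rewrite -sum_nat_const; apply: leq_sum => sigma sD.
  have -> : [set c in free_colours v (W :|: D') sigma | true]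
          = free_colours v (W :|: D') sigma.
    by apply/setP => c; rewrite inE andbT.
  have := card_free_coloursU v W D' sigma.
  suff -> : free_colours v W sigma = L by lia.
  apply/setP => c; have /recolouringsP[eq0 _] := sD.
  by apply/free_coloursP/free_coloursP => h u uW vu; have := h u uW vu;
    rewrite eq0 ?(disjointFr WD').
have pattern :
    #|[set sigma in recolourings sigma0 W D | odd_colours D sigma == P]|
    <= \sum_(c in L) N c.
  rewrite {1 2}DE card_recolourings_step //.
  have -> : \sum_(c in L) N c = \sum_(sigma in recolourings sigma0 W D')
      \sum_(c in L | odd_colours D' sigma == flip c) 1.
    under [RHS]eq_bigr do rewrite big_mkcondr.
    rewrite exchange_big; apply: eq_bigr => c _; rewrite -big_mkcondr /=.
    by rewrite sum1dep_card.
  apply: leq_sum => sigma sD; rewrite sum1dep_card.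
  apply/subset_leq_card/subsetP => c; rewrite inE => /andP[cf /eqP PE].
  rewrite inE (subsetP (free_colours_sub v WD' sD)) //=.
  apply/eqP/setP => c'; rewrite [RHS]inE -PE odd_colours_recolour //.
  by rewrite addbA addbb.
have Nin c : c \in P -> N c * (2 ^ #|D'| * 8 ^ #|P|) <= 8 * T.
  move=> cP; have := IH (flip c); rewrite -/(N c).
  have -> : flip c = P :\ c.
    apply/setP => c'; rewrite !inE; case: (eqVneq c' c) => [->|//].
    by rewrite cP.
  by rewrite (cardsD1 c P) cP expnS !(mulnCA _ 8) leq_mul2l.
have Nout c : c \notin P -> 8 * (N c * (2 ^ #|D'| * 8 ^ #|P|)) <= T.
  move=> cP; have := IH (flip c); rewrite -/(N c).
  have -> : flip c = c |: P.
    apply/setP => c'; rewrite !inE; case: (eqVneq c' c) => [->|//].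
    by rewrite (negPf cP).
  by rewrite cardsU1 cP expnS !(mulnCA _ 8).
have sumP : 8 * (\sum_(c in L) N c * (2 ^ #|D'| * 8 ^ #|P|))
    <= #|P| * (64 * T) + #|L| * T.
  rewrite big_distrr /=.
  apply: (@leq_trans (\sum_(c in L) ((if c \in P then 64 * T else 0) + T))).
    by apply: leq_sum => c _; case: ifPn => [/Nin|/Nout]; move: (N c * _) => m; lia.
  rewrite big_split /= sum_nat_const leq_add2r -big_mkcondr /= sum_nat_const.
  rewrite leq_mul2r; apply/orP; right.
  by apply/subset_leq_card/subsetP => c; rewrite unfold_in => /andP[].
have Ls : 64 * s <= #|L| by apply: large.
rewrite -big_distrl /= in sumP.
rewrite cD expnS -mulnA mulnCA.
have PT : #|P| * T <= s * T by rewrite leq_mul2r (leq_trans PD Ds) orbT.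
have D's : #|D'| < s by lia.
have step2 := leq_mul pattern (leqnn (2 ^ #|D'| * 8 ^ #|P|)).
have LT : 64 * (s * T) <= #|L| * T by rewrite mulnA leq_mul2r Ls orbT.
have LD : T * #|L| <= 2 * (T * (#|L| - #|D'|)) by rewrite mulnCA leq_mul2l; lia.
move: step2 sumP total LT LD PT; rewrite !(mulnCA #|P|) !(mulnC T).
move: (_ * (2 ^ _ * _)) (_ * (2 ^ _ * _)) (#|P| * T) (s * T) (#|L| * T) => b n1 pT sT lT.
move: ((_ - _) * T) => dT.
lia.
Qed.

(** The condition of avoiding [F] is determined by the colours outside [S], so
the colourings avoiding [F] split into classes, each formed of all the proper
recolourings on [S] of one of its members.  Within a class the odd set on
[e :\: S] is constant, and [e] is even only if the odd set on [S] equals it. *)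
Lemma card_even_avoiding s (S e : {set V}) (F : {set {set V}}) :
  gmaxdeg G + 64 * s <= k -> S \subset e -> #|S| = s ->
  (forall f : {set V}, f \in F -> [disjoint f & S]) ->
  2 ^ s * #|[set sigma in avoiding proper_colourings even_on F | even_on e sigma]|
    <= #|avoiding proper_colourings even_on F|.
Proof.
move=> ks Se cS FS; set Av := avoiding _ _ F.
(* [r] labels the classes: it forgets exactly the colours on S. *)
pose r sigma : {ffun V -> option 'I_k} :=
  [ffun v => if v \in S then None else Some (sigma v)].
rewrite -!sum1_card (partition_big r xpredT) //=.
rewrite [leqRHS](partition_big r xpredT) //= big_distrr /=.
apply: leq_sum => rho _; rewrite !sum1dep_card.
have classE : [set sigma in [set sigma in Av | even_on e sigma] | r sigma == rho]
            = [set sigma in [set sigma in Av | r sigma == rho] | even_on e sigma].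
  by apply/setP => sigma; rewrite !in_set andbAC.
rewrite classE; set cls := [set sigma in Av | r sigma == rho].
have [->|[sigma0]] := set_0Vmem cls.
  rewrite (_ : [set _ in _ | _] = set0) ?cards0 ?muln0 //.
  by apply/setP => sigma; rewrite !inE.
rewrite in_set => /andP[s0A /eqP rs0].
have rP sigma : r sigma == rho <-> forall v, v \notin S -> sigma v = sigma0 v.
  rewrite -rs0; split=> [/eqP/ffunP h v vS|h].
    by have := h v; rewrite !ffunE (negPf vS) => -[].
  by apply/eqP/ffunP => v; rewrite !ffunE; case: ifPn => // /h ->.
have clsE : cls = recolourings sigma0 (~: S) S.
  apply/setP => sigma; rewrite in_set; apply/andP/recolouringsP.
    case=> sA /rP eq0; split=> //; move: sA; rewrite !in_set => /andP[+ _].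
    by rewrite setUC setUCr.
  case=> eq0; rewrite setUC setUCr => prop; split; last exact/rP.
  move: s0A; rewrite !in_set prop => /andP[_ /forall_inP h].
  apply/forall_inP => f fF; rewrite /even_on /= (@eq_odd_colours _ _ sigma0).
    exact: h.
  by move=> v vf; apply: eq0; rewrite (disjointFr (FS f fF) vf).
have evenE : [set sigma in cls | even_on e sigma] =
  [set sigma in recolourings sigma0 (~: S) S |
     odd_colours S sigma == odd_colours (e :\: S) sigma0].
  apply/setP => sigma; rewrite [LHS]in_set [RHS]in_set clsE.
  apply: andb_id2l => /recolouringsP[eq0 _]; rewrite /even_on /=.
  rewrite -(@eq_odd_colours (e :\: S) sigma); last first.
    by move=> v /setDP[_ vS]; apply: eq0.
  have disj : [disjoint S & e :\: S].
    by rewrite -setI_eq0; apply/eqP/setP => v; rewrite !inE; case: (v \in S).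
  have {1}-> : e = S :|: (e :\: S) by rewrite -{1}(setID e S) (setIidPr Se).
  apply/eqP/eqP => [|SE]; last first.
    by apply/setP => c; rewrite odd_coloursU // SE addbb inE.
  move=> /setP h; apply/setP => c; have := h c.
  rewrite odd_coloursU // [in RHS]inE.
  by case: (c \in _); case: (c \in _).
have p0 : proper_on (~: S) sigma0.
  move: s0A; rewrite !in_set => /andP[/proper_onP p _].
  by apply/proper_onP => u v _ _; apply: p; rewrite inE.
rewrite evenE clsE.
apply: leq_trans (card_odd_colours_pattern (odd_colours (e :\: S) sigma0)
  (s := s) _ _ p0 _).
- by rewrite mulnC leq_mul2l cS leq_pmulr ?expn_gt0 ?orbT.
- by rewrite -setI_eq0 setIC setICr.
- by rewrite cS.
- move=> v _; have := card_free_colours_ge v (~: S) sigma0.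
  have : gdeg G v <= gmaxdeg G by apply: leq_bigmax.
  lia.
Qed.

End Colourings.

(** * Existence of odd colourings *)

Lemma exists_proper_colouring (V : finType) (G : sgraph V) k :
  gmaxdeg G < k -> exists sigma : {ffun V -> 'I_k}, proper_on G setT sigma.
Proof.
move=> Gk.
suff ex (U : {set V}) : exists sigma : {ffun V -> 'I_k}, proper_on G U sigma by [].
have [n] := ubnP #|U|; elim: n U => // n IHn U Un.
have [->|[v vU]] := set_0Vmem U.
  exists [ffun=> Ordinal (leq_ltn_trans (leq0n _) Gk)].
  by apply/proper_onP => u v; rewrite inE.
have [|sigma sU] := IHn (U :\ v); first by have := cardsD1 v U; rewrite vU; lia.
have /card_gt0P[c cf] : 0 < #|free_colours G v (U :\ v :|: set0) sigma|.
  have := card_free_colours_ge G v (U :\ v :|: set0) sigma.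
  have : gdeg G v <= gmaxdeg G by apply: leq_bigmax.
  lia.
exists (recolour sigma v c).
have sin : sigma \in recolourings G sigma (U :\ v) set0.
  by rewrite recolourings0 ?set11.
have vn : v \notin U :\ v :|: set0 by rewrite !inE eqxx.
move: cf; rewrite -(recolour_in c vn sin) => /recolouringsP[_].
by rewrite setU0 setUC setD1K.
Qed.

(** The bound [4 * (s * hmaxdeg H) <= 2 ^ s] is the local lemma condition: an
edge is even with conditional probability at most [2 ^- s], and at most
[s * hmaxdeg H] edges meet the [s] vertices selected in it. *)
Lemma exists_odd_colouring (V : finType) (G : sgraph V) (H : hypergraph V) s :
  2 <= s -> 4 * (s * hmaxdeg H) <= 2 ^ s ->
  (forall e, e \in hedges H -> s <= #|e|) ->
  exists sigma : V -> 'I_(gmaxdeg G + 64 * s), odd_colouring G H sigma.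
Proof.
move=> s2 sH es; set k := gmaxdeg G + 64 * s.
pose S (e : {set V}) : {set V} := odflt set0 [pick S : {set V} | (S \subset e) && (#|S| == s)].
have SP e : e \in hedges H -> S e \subset e /\ #|S e| = s.
  move=> /es/exists_subset_card[S0 S0e S0s]; rewrite /S; case: pickP => [S1|/(_ S0)].
    by case/andP=> ? /eqP.
  by rewrite S0e S0s eqxx.
pose nb (e : {set V}) : {set {set V}} := [set f in hedges H | ~~ [disjoint f & S e]].
have [sigma0 p0] : exists sigma : {ffun V -> 'I_k}, proper_on G setT sigma.
  by apply: exists_proper_colouring; rewrite /k; lia.
have : 0 < #|avoiding (proper_colourings G k) (@even_on V k) (hedges H)|.
  apply: (@lopsided_local_lemma _ _ _ _ _ nb (s * hmaxdeg H) (2 ^ s)) => //.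
  - move=> e F eH FH Fnb; have [Se cS] := SP e eH.
    apply: card_even_avoiding Se cS _ => // f fF.
    have := disjointFr Fnb fF.
    by rewrite inE (subsetP FH _ fF) /= => /negbFE.
  - move=> e eH; have [Se cS] := SP e eH.
    have sub : nb e \subset \bigcup_(v in S e) [set f in hedges H | v \in f].
      apply/subsetP => f; rewrite inE => /andP[fH].
      rewrite -setI_eq0 => /set0Pn[v /setIP[vf vS]].
      by apply/bigcupP; exists v => //; rewrite inE fH.
    apply: leq_trans (subset_leq_card sub) _.
    rewrite -cS -sum_nat_const.
    elim/big_rec2: _ => [|v m B _ Bm]; first by rewrite cards0.
    apply: leq_trans (leq_card_setU _ _) (leq_add _ Bm).
    exact: (leq_bigmax (F := hdeg H)).
  - by apply: (@leq_trans (2 ^ 2)); rewrite ?leq_exp2l.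
  - by apply/card_gt0P; exists sigma0; rewrite inE.
case/card_gt0P => sigma; rewrite inE => /andP[].
rewrite inE => /proper_onP prop /forall_inP noteven.
exists sigma; split=> [u v|e eH]; first exact: prop.
by have /set0Pn[c] := noteven e eH; rewrite inE; exists c.
Qed.

Lemma hminsize_le (V : finType) (H : hypergraph V) e :
  e \in hedges H -> hminsize H <= #|e|.
Proof.
move=> eH; rewrite /hminsize; have := mem_index_enum e.
elim: (index_enum _) => // f r IHr; rewrite inE big_cons.
case/predU1P=> [<-|/IHr le]; first by rewrite eH geq_minl.
by case: ifP => // _; apply: leq_trans (geq_minr _ _) le.
Qed.

Local Open Scope ring_scope.

(* The hypothesis (2 <= hmaxdeg H)%N makes the logarithm positive. With
   maximum degree 0 or 1 the bound would read k <= gmaxdeg G, which is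
   impossible already for complete graphs. *)
Theorem theorem1p5 (R : realType) :
  exists C : R,
    forall (V : finType) (G : sgraph V) (H : hypergraph V),
      (2 <= hmaxdeg H)%N ->
      C * ln ((hmaxdeg H)%:R : R) <= (hminsize H)%:R ->
      exists k : nat,
        (k%:R : R) <= (gmaxdeg G)%:R + C * ln ((hmaxdeg H)%:R : R) /\
        exists sigma : V -> 'I_k, odd_colouring G H sigma.
Proof.
have ln2 : 0 < ln (2%:R : R) by rewrite ln_gt0 // ltr1n.
(* With s = 8 * L for L = trunc_log 2 D, there are 64 * s = 512 * L extra
   colours, and L <= ln D / ln 2. *)
exists (512%:R / ln 2%:R) => V G H D2; set D := hmaxdeg H in D2 *.
pose L := trunc_log 2 D; pose s := (8 * L)%N.
have D0 : (0 < D)%N := ltn_trans (isT : 0 < 1)%N D2.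
have L0 : (0 < L)%N by rewrite trunc_log_gt0.
have LD : (512 * L)%:R <= 512%:R / ln 2%:R * ln (D%:R : R).
  rewrite natrM -mulrA ler_wpM2l ?ler0n // mulrC ler_pdivlMr //.
  rewrite mulr_natl -lnXn ?ltr0n // -natrX ler_ln ?posrE ?ltr0n ?expn_gt0 //.
  by rewrite ler_nat trunc_logP.
move=> sizeH; exists (gmaxdeg G + 64 * s)%N; split.
  by rewrite natrD lerD2l mulnA.
apply: exists_odd_colouring.
- by rewrite /s; lia.
(* With x = 2 ^ L: D < 2 * x and L < x, so 4 * s * D is at most 64 * x ^ 2,
     and 64 <= x ^ 6 since L > 0. *)
- have DL : (D < 2 ^ L.+1)%N := trunc_log_ltn D (isT : 1 < 2)%N.
  have LE : (L < 2 ^ L)%N by apply: ltn_expl.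
  have E : (2 ^ s = 2 ^ L * 2 ^ L * (2 ^ L) ^ 6)%N.
    by rewrite -expnM -!expnD; congr expn; rewrite /s; lia.
  have X6 : (2 ^ 6 <= (2 ^ L) ^ 6)%N by rewrite leq_exp2r // -{1}(expn1 2) leq_exp2l.
  rewrite E -/D; apply: leq_trans (leq_mul (leqnn _) X6).
  move: DL; rewrite expnS /s; nia.
- move=> e eH; apply: leq_trans (hminsize_le eH).
  rewrite -(ler_nat R); apply: le_trans sizeH; apply: le_trans LD.
  by rewrite ler_nat /s leq_mul2r orbT.
Qed.
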